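(* Let $K$ be a commutative field of characteristic $0$ and let $A$ be a noncommutative Jordan algebra over $K$ without zero divisors which contains at least one left linearly invertible element. Then $A$ has a unit element.
   Context: Algebras are vector spaces with a bilinear product, not assumed associative or unital and of arbitrary dimension. $(x,y,z)=(xy)z-x(yz)$. An algebra is noncommutative Jordan if $(x,y,x)=0$ and $(x^2,y,x)=0$ for all $x,y$. ''Without zero divisors'' means $xy=0$ implies $x=0$ or $y=0$. A nonzero element $x\in A$ is left linearly invertible if $L_x:A\to A$, $y\mapsto xy$, is bijective. *)

(* Defs.v *)
From HB Require Import structures.
From mathcomp Require Import all_boot all_order all_algebra.

Set Implicit Arguments.
Unset Strict Implicit.
Unset Printing Implicit Defensive.

Import GRing.Theory.
Local Open Scope ring_scope.

(* An algebra over K, not assumed associative, commutative, unital or         *)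
(* finite-dimensional, is an lmodType K equipped with a product               *)
(* mul : {bilinear A -> A -> A}.                                              *)

Definition associator (K : fieldType) (A : lmodType K)
    (mul : {bilinear A -> A -> A}) (x y z : A) : A :=
  mul (mul x y) z - mul x (mul y z).

Definition noncommutative_Jordan (K : fieldType) (A : lmodType K)
    (mul : {bilinear A -> A -> A}) : Prop :=
  (forall x y : A, associator mul x y x = 0) /\
  (forall x y : A, associator mul (mul x x) y x = 0).

Definition no_zero_divisors (K : fieldType) (A : lmodType K)
    (mul : {bilinear A -> A -> A}) : Prop :=
  forall x y : A, mul x y = 0 -> x = 0 \/ y = 0.

Definition left_linearly_invertible (K : fieldType) (A : lmodType K)
    (mul : {bilinear A -> A -> A}) (x : A) : Prop :=
  x <> 0 /\ bijective (fun y : A => mul x y).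

Definition is_unit_element (K : fieldType) (A : lmodType K)
    (mul : {bilinear A -> A -> A}) (e : A) : Prop :=
  forall x : A, mul e x = x /\ mul x e = x.

(* Main.v *)
Require Import Defs.
From HB Require Import structures.
From mathcomp Require Import all_boot all_order all_algebra.

Set Implicit Arguments.
Unset Strict Implicit.
Unset Printing Implicit Defensive.

Import GRing.Theory.
Local Open Scope ring_scope.

(* If L_a is bijective, the e with a e = a satisfies e a = a by flexibility,  *)
(* and linearizing the Jordan identity gives (a^2, y, e) = 0, whence e^2 = e  *)
(* on cancelling a^2. The same linearization at e shows that                  *)
(* u = e z + z e - z satisfies e u = u e = u for every z, so that w = z - u   *)
(* lies in the Peirce half-space e w + w e = w. This space is zero: w^2 and   *)
(* w^3 are fixed by left and right multiplication by e, while the associators *)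
(* (w^2, w, e) and (e, w, w^2) vanish, so cancelling w^2 gives w e = w = e w, *)
(* that is w = 2 w. Hence z = u for every z.                                  *)

Section NoncommutativeJordan.

Variables (K : fieldType) (A : lmodType K) (mul : {bilinear A -> A -> A}).

Local Notation "x ** y" := (mul x y) (at level 40, left associativity).
Local Notation assoc := (associator mul).

(** The engine is [Jordan_linear]. Whenever [anticomm x e] is a multiple of [x], flexibility kills
    its second term, leaving [(x^2, y, e) = 0] for all [y]; cancellation then turns vanishing
    associators into equations fixing elements under [e]. This produces an idempotent in
    [left_fixed_idem], removes its half-space in [idem_half_eq0], and [idem_is_unit] concludes. *)

Definition anticomm (x y : A) : A := mul x y + mul y x.

Lemma anticommC x y : anticomm x y = anticomm y x.
Proof. exact: addrC. Qed.

Lemma anticommDl x x' y : anticomm (x + x') y = anticomm x y + anticomm x' y.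
Proof. by rewrite /anticomm linearDl linearDr addrACA. Qed.

Lemma anticommNr x y : anticomm x (- y) = - anticomm x y.
Proof. by rewrite /anticomm linearNl linearNr opprD. Qed.

Lemma anticommBr x y y' : anticomm x (y - y') = anticomm x y - anticomm x y'.
Proof. by rewrite anticommC anticommDl ![anticomm _ x]anticommC anticommNr. Qed.

Lemma mul_sqrD x y : (x + y) ** (x + y) = x ** x + y ** y + anticomm x y.
Proof. by rewrite linearDl !linearDr [y ** x + _]addrC addrACA. Qed.

Lemma associatorDl x x' y z : assoc (x + x') y z = assoc x y z + assoc x' y z.
Proof. by rewrite /associator !linearDl opprD addrACA. Qed.

Lemma associatorDr x y z z' : assoc x y (z + z') = assoc x y z + assoc x y z'.
Proof. by rewrite /associator !linearDr opprD addrACA. Qed.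

Lemma associatorNl x y z : assoc (- x) y z = - assoc x y z.
Proof. by rewrite /associator !linearNl opprB addrC opprK. Qed.

Lemma associatorNr x y z : assoc x y (- z) = - assoc x y z.
Proof. by rewrite /associator !linearNr opprB addrC opprK. Qed.

Hypothesis two_neq0 : 2%:R != 0 :> K.

Lemma double_eq0 (x : A) : x + x = 0 -> x = 0.
Proof.
move=> x2; apply/eqP; move/eqP: x2.
by rewrite -mulr2n -scaler_nat scaler_eq0 (negPf two_neq0).
Qed.

Hypothesis ncJ : noncommutative_Jordan mul.

Lemma flexible_mul x y : (x ** y) ** x = x ** (y ** x).
Proof. by apply/subr0_eq; exact: ncJ.1. Qed.

Lemma flexible_linear x y z : assoc x y z = - assoc z y x.
Proof.
apply/eqP; rewrite -addr_eq0; apply/eqP.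
have := ncJ.1 (x + z) y.
by rewrite associatorDl !associatorDr !ncJ.1 add0r addr0.
Qed.

(** Expanding the Jordan identity at a sum gives only [J u v + J v u = 0]. Since [J] is quadratic in
    its first argument and linear in its second, replacing [z] by [- z] also makes [J] symmetric, so
    twice [J] vanishes. *)
Lemma Jordan_linear x y z : assoc (x ** x) y z + assoc (anticomm x z) y x = 0.
Proof.
pose J x z := assoc (x ** x) y z + assoc (anticomm x z) y x.
have J_skew u v : J u v + J v u = 0.
  have := ncJ.2 (u + v) y.
  (* The instances are explicit because unification unfolds anticomm to a sum. *)
  rewrite mul_sqrD !associatorDr !(associatorDl _ (anticomm u v)).
  rewrite !(associatorDl (u ** u)) !ncJ.2 add0r addr0 => <-.
  rewrite /J (anticommC v) addrACA [RHS]addrACA.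
  by rewrite (addrC (assoc (u ** u) y v)).
have := J_skew x (- z).
have -> : J x (- z) = - J x z.
  by rewrite /J associatorNr anticommNr associatorNl [RHS]opprD.
have -> : J (- z) x = J z x.
  rewrite /J (anticommC _ x) anticommNr associatorNl associatorNr opprK.
  by rewrite linearNl linearNr opprK anticommC.
rewrite addrC => /subr0_eq Jsym.
by apply: double_eq0; rewrite -/(J x z) -{2}Jsym J_skew.
Qed.

(** Polarization of [Jordan_linear] in [x]; it is what reaches the cube in [idem_half_eq0]. *)
Lemma Jordan_trilinear x z t y :
  assoc (anticomm x t) y z + assoc (anticomm x z) y t +
    assoc (anticomm t z) y x = 0.
Proof.
have := Jordan_linear (x + t) y z.
rewrite mul_sqrD anticommDl !associatorDr (associatorDl _ (anticomm x t)).
rewrite (associatorDl (x ** x)) !(associatorDl (anticomm x z)).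
rewrite (addrC (assoc (anticomm x z) y t)) (addrACA (assoc (anticomm x z) y x)).
rewrite (addrACA (assoc (x ** x) y z + _)) (addrACA (assoc (x ** x) y z)).
rewrite !Jordan_linear !add0r => <-.
by rewrite (addrC (assoc (anticomm t z) y x)) addrA.
Qed.

Hypothesis nzd : no_zero_divisors mul.

Lemma mul_cancell x y z : x <> 0 -> x ** y = x ** z -> y = z.
Proof.
move=> x0 xyz; have [//|/subr0_eq //] : x = 0 \/ y - z = 0.
by apply: nzd; rewrite linearBr xyz subrr.
Qed.

Lemma mul_cancelr x y z : x <> 0 -> y ** x = z ** x -> y = z.
Proof.
move=> x0 yzx; have [/subr0_eq|//] : y - z = 0 \/ x = 0.
  by apply: nzd; rewrite linearBl yzx subrr.
by [].
Qed.

Section Idempotent.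

Variables (e : A).
Hypotheses (e0 : e <> 0) (eidem : e ** e = e).

Lemma idem_fix x : assoc x e e = 0 -> e ** x = x /\ x ** e = x.
Proof.
move=> xee; split; last first.
  by apply: (mul_cancelr e0); move/subr0_eq: xee; rewrite eidem.
apply: (mul_cancell e0); move/eqP: xee.
by rewrite flexible_linear oppr_eq0 => /eqP/subr0_eq; rewrite eidem.
Qed.

Lemma idem_half_eq0 w : anticomm w e = w -> w = 0.
Proof.
move=> we_half; have [//|/eqP w0] := eqVneq w 0.
have w2 y : assoc (w ** w) y e = 0.
  by have := Jordan_linear w y e; rewrite we_half ncJ.1 addr0.
have w2' y : assoc e y (w ** w) = 0 by rewrite flexible_linear w2 oppr0.
have w20 : w ** w <> 0 by move/nzd => [].
have [ew2 w2e] := idem_fix (w2 e).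
have wC : w ** (w ** w) = w ** w ** w by rewrite flexible_mul.
(* Taking [t = w^2], the first term is twice the desired associator, and the other two are multiples
   of [(w^2, y, w) = 0], using flexibility for [(w, y, w^2)]. *)
have w3 y : assoc (w ** w ** w) y e = 0.
  have := Jordan_trilinear w e (w ** w) y.
  rewrite we_half /anticomm wC w2e ew2 associatorDl associatorDl ncJ.2.
  by rewrite (flexible_linear w) ncJ.2 oppr0 !addr0 => /double_eq0.
have [ew3 w3e] := idem_fix (w3 e).
have we : w ** e = w.
  by apply: (mul_cancell w20); have /subr0_eq := w2 w; rewrite w3e.
have ew : e ** w = w.
  by apply: (mul_cancelr w20); have /subr0_eq := w2' w; rewrite wC ew3.
apply/(addrI w); rewrite addr0 -[RHS]we_half.
by rewrite /anticomm we ew.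
Qed.

Lemma idem_is_unit : is_unit_element mul e.
Proof.
move=> z; pose u := anticomm e z - z.
have [eu ue] : e ** u = u /\ u ** e = u.
  apply: idem_fix; have := Jordan_linear e e z.
  rewrite eidem flexible_linear addrC => uee.
  by rewrite /u associatorDl associatorNl.
suff -> : z = u by [].
apply/subr0_eq/idem_half_eq0.
rewrite anticommC anticommBr {2}/anticomm eu ue opprD addrA.
by rewrite -[anticomm e z](subrK z) -/u (addrC u z) addrK.
Qed.

End Idempotent.

Lemma left_fixed_idem a e : a <> 0 -> a ** e = a -> e <> 0 /\ e ** e = e.
Proof.
move=> a0 ae.
have e0 : e <> 0 by move=> e0; apply: a0; rewrite -ae e0 linear0r.
have ea : e ** a = a.
  by apply: (mul_cancell a0); rewrite -flexible_mul ae.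
have a20 : a ** a <> 0 by move/nzd => [].
have a2 y : assoc (a ** a) y e = 0.
  have := Jordan_linear a y e.
  by rewrite /anticomm ae ea associatorDl !ncJ.1 !addr0.
(* The Jordan identity at [a] gives [(a^2 e) a = a^2 (e a) = a^2 a]. *)
have a2e : a ** a ** e = a ** a.
  apply: (mul_cancelr a0).
  have /subr0_eq := ncJ.2 a e.
  by rewrite ea.
split=> //; apply: (mul_cancell a20).
by have /subr0_eq := a2 e; rewrite !a2e.
Qed.

End NoncommutativeJordan.

Theorem mainTheorem18 (K : fieldType) (char0 : [pchar K] =i pred0)
    (A : lmodType K) (mul : {bilinear A -> A -> A})
    (ncJ : noncommutative_Jordan mul)
    (nzd : no_zero_divisors mul)
    (inv : exists a : A, left_linearly_invertible mul a) :
  exists e : A, is_unit_element mul e.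
Proof.
have two_neq0 : 2%:R != 0 :> K.
  by have := char0 2%N; rewrite !inE /= => /negbT.
have [a [a0 [g _ gK]]] := inv.
have [e0 eidem] := left_fixed_idem two_neq0 ncJ nzd a0 (gK a).
by exists (g a); apply: idem_is_unit.
Qed.
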